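(* Let $f:\mathbb{R}\to[0,\infty)$ be a nonnegative function with $f\in L^1(\mathbb{R})$, and let $N$ be a positive integer. If $$Q(z)=\frac{|\widehat f(z)|}{\pi\sqrt{10}\int_0^{1/z} f^*(x)\,dx}>N$$ for some $z>0$, then $\#crests(f)>N$ (where $\#crests(f)=\infty$ is allowed).
   Context: The Fourier transform of $f\in L^1(\mathbb{R})$ is $\widehat f(z)=\int_{\mathbb{R}} f(x)e^{-ixz}\,dx$, $z\in\mathbb{R}$. The decreasing rearrangement of $f$ is $f^*(x)=\inf\{\alpha>0 : |\{t:|f(t)|>\alpha\}|\le x\}$, where $|\cdot|$ of a set is Lebesgue measure. ''Increasing'' and ''decreasing'' are meant in the wide (non-strict) sense. A nonnegative function $f$ on $\mathbb{R}$ crests once, written $\#crests(f)=1$, if there exists a point $b\in\mathbb{R}$ such that $f(x)$ is increasing for $x<b$ and decreasing for $x>b$. Two functions have almost disjoint support if the intersection of their supports has Lebesgue measure zero. In general, for a nonnegative function $f$ on $\mathbb{R}$, $\#crests(f)$ is the minimum of all integers $N\ge 1$ such that $f=\sum_{i=1}^N f_i$ for some nonnegative functions $f_1,\dots,f_N$ with (pairwise) almost disjoint supports, each of which crests once; if no such $N$ exists, $\#crests(f)=\infty$. *)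

(* Defs.v *)
From HB Require Import structures.
From mathcomp Require Import all_boot all_order all_algebra.
From mathcomp Require Import all_classical all_reals all_analysis.
From mathcomp Require Import complex.

Set Implicit Arguments.
Unset Strict Implicit.
Unset Printing Implicit Defensive.

Import Order.TTheory GRing.Theory Num.Theory.
Import numFieldNormedType.Exports.

Local Open Scope classical_set_scope.
Local Open Scope complex_scope.
Local Open Scope ring_scope.

(* The completed measure is used throughout, so that "measurable" and "L^1"
   refer to Lebesgue (not just Borel) measurable functions. *)
Notation leb R := (@completed_lebesgue_measure R).

Definition L1 (R : realType) (f : R -> R) : Prop :=
  (leb R).-integrable [set: R] (EFin \o f).

Definition Cintegral (R : realType) (g : R -> R[i]) : R[i] :=
  (\int[leb R]_(x in [set: R]) complex.Re (g x)) +i*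
  (\int[leb R]_(x in [set: R]) complex.Im (g x)).

(* e^(i t) for a real t *)
Definition cexpi (R : realType) (t : R) : R[i] := cos t +i* sin t.

Definition fourier (R : realType) (f : R -> R) (z : R) : R[i] :=
  Cintegral (fun x => (f x)%:C * cexpi (- (x * z))).

(* Extended-real valued: the value at 0 is +oo when f is essentially
   unbounded. *)
Definition rearrangement (R : realType) (f : R -> R) (x : R) : \bar R :=
  ereal_inf [set a%:E | a in
    [set a : R | 0 < a /\ (leb R [set t : R | (a < `|f t|)%R] <= x%:E)%E]].

(* For f in L^1 and z > 0 the integral in the denominator is finite, so fine
   loses nothing; if f = 0 a.e. the quotient 0 / 0 is 0. *)
Definition Q (R : realType) (f : R -> R) (z : R) : R :=
  ComplexField.Normc.normc (fourier f z) /
  (pi * Num.sqrt 10 *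
   fine (\int[leb R]_(x in `[0%R, (1 / z)%R]) rearrangement f x)%E).

Definition crests_once (R : realType) (f : R -> R) : Prop :=
  exists b : R,
    {in `]-oo, b[ &, {homo f : x y / x <= y}} /\
    {in `]b, +oo[ &, {homo f : x y /~ x <= y}}.

(* The support is the set where the function does not vanish; for functions
   cresting once, passing to its closure only adds a null set. *)
Definition almost_disjoint_support (R : realType) (f g : R -> R) : Prop :=
  leb R ([set x : R | f x != 0] `&` [set x : R | g x != 0]) = 0%E.

Definition crest_decomposable (R : realType) (f : R -> R) (n : nat) : Prop :=
  (0 < n)%N /\
  exists F : 'I_n -> R -> R,
    [/\ forall i x, 0 <= F i x,
        forall i, crests_once (F i),
        forall i j, i != j -> almost_disjoint_support (F i) (F j)
      & forall x, f x = \sum_(i < n) F i x].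

Definition crests (R : realType) (f : R -> R) : \bar R :=
  if pselect (exists n, `[< crest_decomposable f n >]) is left fin
  then (ex_minn fin)%:R%:E else +oo%E.

(* Main.v *)
Require Import Defs.
From HB Require Import structures.
From mathcomp Require Import all_boot all_order all_algebra.
From mathcomp Require Import all_classical all_reals all_analysis.
From mathcomp Require Import complex.
From mathcomp Require Import measurable_realfun.
From mathcomp Require Import ring lra.

(** The quotient Q is controlled by oscillation.  Suppose f is a sum of n
    functions g that each crest once, put h = pi / z, and let w(x) be
    cos (- x z) or sin (- x z), so that w(x + h) = - w(x).  Translating by h
    gives
      2 * \int g w = \int (g(x) - g(x + h)) w(x) dx,
    and when g rises up to b and falls afterwards the integral of
    |g(x) - g(x + h)| telescopes on either side of the crest: it is at most
    twice the integral of g over [b - h, b + h] ([crest_oscillation]).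

    That interval has length 2 pi / z and g <= f, so the integral of g over it
    is at most 2 pi times the integral over [0, 1 / z] of the decreasing
    rearrangement of f.  This is the Hardy-Littlewood inequality with a dilation
    factor ([hardy_littlewood]): Tonelli turns both sides into integrals over
    the levels t >= 0, where the left integrand is at most min (|E|, m t) and
    the right one is k min (c, m t), with m t the measure of {|f| > t}.

    Adding the n pieces bounds the real and the imaginary part of the Fourier
    transform by 2 pi n times the denominator integral, hence its modulus by
    sqrt 8 pi n times that integral, and sqrt 8 <= sqrt 10.  So n crests force
    Q <= n.

    Translation invariance is needed for the completed measure.  Functions
    cresting once are Borel, so their integrals for that measure are Borel
    integrals, for which it follows from the uniqueness of Lebesgue measure. *)

Import Order.TTheory GRing.Theory Num.Theory.
Import numFieldNormedType.Exports.

Local Open Scope ring_scope.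

(** * Borel and completed Lebesgue integrals *)

(** The two measurable structures on the line: the Carathéodory sets, which
    carry the completed measure, and the Borel sets. *)
Local Notation completedR R := (caratheodory_type (R := R) (T := ocitv_type R)
  (wlength idfun)^*%mu).
Local Notation borelR R := (measurableTypeR R).

Section Transfer.
Context {R : realType}.
Local Open Scope classical_set_scope.
Local Notation mu := (@lebesgue_measure R).

Lemma measurable_leb (A : set (borelR R)) :
  measurable A -> measurable (A : set (completedR R)).
Proof. exact: sub_caratheodory. Qed.

Lemma measurable_id_leb :
  measurable_fun [set: completedR R] (id : completedR R -> borelR R).
Proof. by move=> _ A mA; rewrite setTI; exact: measurable_leb. Qed.

Lemma measurable_fun_leb d (T : measurableType d) (g : borelR R -> T) :
  measurable_fun [set: borelR R] g ->
  measurable_fun [set: completedR R] (g : completedR R -> T).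
Proof. by move=> mg; exact: measurableT_comp mg measurable_id_leb. Qed.

(** The Borel measure is the image of the completed one by the identity, so
    this is a change of variables. *)
Lemma ge0_integral_leb (D : set (borelR R)) (g : borelR R -> \bar R) :
  measurable D -> measurable_fun [set: borelR R] g ->
  (forall x, (0 <= g x)%E) ->
  (\int[leb R]_(x in D) g x = \int[mu]_(x in D) g x)%E.
Proof.
move=> mD mg g0.
have := @ge0_integral_pushforward _ _ _ _ _ _ measurable_id_leb (leb R) D g.
rewrite preimage_id => <-//; last exact: measurable_funTS.
Qed.

Lemma integrable_leb (g : borelR R -> \bar R) :
  measurable_fun [set: borelR R] g ->
  (leb R).-integrable [set: completedR R] g -> mu.-integrable [set: borelR R] g.
Proof.
move=> mg /integrableP[_ ig]; apply/integrableP; split => //.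
by rewrite -ge0_integral_leb//; exact: measurableT_comp.
Qed.

Lemma integral_leb (g : borelR R -> \bar R) :
  measurable_fun [set: borelR R] g ->
  (\int[leb R]_x g x = \int[mu]_x g x)%E.
Proof.
move=> mg; rewrite integralE [RHS]integralE !ge0_integral_leb//.
  exact: measurable_funeneg.
exact: measurable_funepos.
Qed.

(** A named translation, so that its image measure can be inferred to be a
    measure. *)
Definition shift_by (h : R) (x : borelR R) : borelR R := x + h.

Lemma measurable_shift_by h : measurable_fun [set: borelR R] (shift_by h).
Proof. by apply: measurable_funD. Qed.

HB.instance Definition _ h :=
  isMeasurableFun.Build _ _ _ _ (shift_by h) (measurable_shift_by h).

(** Both measures give a half-open interval its length, which determines
    Lebesgue measure. *)
Lemma lebesgue_measure_shift_by (h : R) (A : set (borelR R)) : measurable A ->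
  pushforward mu (shift_by h) A = mu A.
Proof.
move=> mA; apply/esym/lebesgue_measure_unique => //= _ [[a b]] _ <- /=.
rewrite /pushforward.
rewrite [X in _ = mu X](_ : _ = `]a - h, b - h]%classic); last first.
  by apply/seteqP; split=> x /=; rewrite !in_itv/= /shift_by ltrBlDr lerBrDr.
by rewrite !lebesgue_measure_itv/= !lte_fin ltrD2r -!EFinB opprB addrA subrK.
Qed.

Lemma ge0_integral_shift (h : R) (g : R -> \bar R) :
  measurable_fun [set: borelR R] g -> (forall x, (0 <= g x)%E) ->
  (\int[mu]_x g (x + h)%R = \int[mu]_x g x)%E.
Proof.
move=> mg g0.
have := @ge0_integral_pushforward _ _ _ _ _ _ (measurable_shift_by h) mu setT g.
rewrite preimage_setT => /(_ measurableT mg (fun x _ => g0 x)) <-.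
by apply: eq_measure_integral => A mA _; exact: lebesgue_measure_shift_by.
Qed.

Lemma Rintegral_shift (h : R) (f : R -> R) :
  measurable_fun [set: borelR R] f ->
  \int[mu]_x f (x + h) = \int[mu]_x f x.
Proof.
move=> mf; congr fine; rewrite integralE [RHS]integralE/=.
have mE : measurable_fun [set: borelR R] (EFin \o f) by exact/measurable_EFinP.
rewrite -(@ge0_integral_shift h ((EFin \o f)^\+)%E)//; last first.
  exact: measurable_funepos.
rewrite -(@ge0_integral_shift h ((EFin \o f)^\-)%E)//; last first.
  exact: measurable_funeneg.
by congr (_ - _)%E; apply: eq_integral => x _; rewrite !unlock.
Qed.

Lemma integrable_shift (h : R) (f : R -> R) :
  mu.-integrable [set: borelR R] (EFin \o f) ->
  mu.-integrable [set: borelR R] (fun x => (f (x + h))%:E).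
Proof.
move=> /integrableP[mf intf]; apply/integrableP; split.
  exact: (measurableT_comp mf (measurable_shift_by h)).
rewrite (@ge0_integral_shift h (fun x => `|(f x)%:E|)%E)//.
exact: measurableT_comp mf.
Qed.

End Transfer.

(** * Functions that crest once *)

Section CrestsOnce.
Context {R : realType}.
Local Open Scope classical_set_scope.
Local Notation mu := (@lebesgue_measure R).

(** Each superlevel set meets either side of the crest in an interval; the
    value at the crest itself is arbitrary. *)
Lemma crests_once_measurable (f : R -> R) :
  crests_once f -> measurable_fun [set: borelR R] f.
Proof.
move=> [b [fi fd]].
apply: (measurability (@RGenCInfty.G R)) => [|/= _ [_] [r] -> <-].
  exact: RGenCInfty.measurableE.
rewrite setTI (_ : _ @^-1` _ = [set x | r <= f x]); last first.
  by apply/seteqP; split=> x /=; rewrite in_itv/= andbT.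
set A := [set x | r <= f x]; have AE x : A x = (r <= f x) by [].
have -> : A = (A `&` `]-oo, b[) `|` (A `&` [set b]) `|` (A `&` `]b, +oo[).
  apply/seteqP; split=> [x Ax|x [[|]|] []//].
  have [xb|xb|xb] := ltgtP x b.
  - by left; left; split => //=; rewrite in_itv.
  - by right; split => //=; rewrite in_itv/= andbT.
  - by left; right; split; rewrite -?xb.
apply: measurableU; first apply: measurableU;
  apply: is_interval_measurable => s t/=; rewrite !AE.
- rewrite !in_itv/= => -[fs sb] [ft tb] u /andP[su ut].
  have ub := le_lt_trans ut tb; rewrite AE in_itv/= ub; split => //.
  by rewrite (le_trans fs)// fi// in_itv.
- move=> [fs sb] [_ tb] u; rewrite sb tb -eq_le => /eqP ub.
  by rewrite AE -ub -sb.
- rewrite !in_itv/= !andbT => -[fs sb] [ft tb] u /andP[su ut].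
  have ub := lt_le_trans sb su; rewrite AE in_itv/= ub; split => //.
  by rewrite (le_trans ft)// fd// in_itv/= andbT.
Qed.

(** Since w changes sign under translation by h, twice the integral of g w is
    the integral of (g(x) - g(x + h)) w(x).  The difference g(x) - g(x + h) is
    nonnegative for x > b and nonpositive for x < b - h, and in between it is
    at most g(x) + g(x + h) in absolute value.  All three cases read
      |g(x) - g(x + h)| <= g(x) a(x) + g(x + h) c(x)
    with signs a and c, and translating the second term back turns the
    integral of the right-hand side into that of g(x) (a(x) + c(x - h)), where
    a(x) + c(x - h) is 2 on [b - h, b + h] and 0 elsewhere. *)
Lemma crest_oscillation (g w : R -> R) (h b : R) : 0 < h ->
  (forall x, 0 <= g x) ->
  {in `]-oo, b[%R &, {homo g : x y / x <= y}} ->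
  {in `]b, +oo[%R &, {homo g : x y /~ x <= y}} ->
  mu.-integrable [set: borelR R] (EFin \o g) ->
  measurable_fun [set: borelR R] w -> (forall x, `|w x| <= 1) ->
  (forall x, w (x + h) = - w x) ->
  `|\int[mu]_x (g x * w x)| <= \int[mu]_(x in `[b - h, b + h]) g x.
Proof.
move=> h0 g0 gi gd ig mw w1 wh.
pose a x : R := if x < b - h then -1 else 1.
pose c x : R := if x <= b then 1 else -1.
have ma : measurable_fun [set: borelR R] a.
  by apply: measurable_fun_ifT => //; exact: measurable_fun_ltr.
have mc : measurable_fun [set: borelR R] c.
  by apply: measurable_fun_ifT => //; exact: measurable_fun_ler.
have a1 x : `|a x| <= 1 by rewrite /a; case: ifP; rewrite ?normrN normr1.
have c1 x : `|c x| <= 1 by rewrite /c; case: ifP; rewrite ?normrN normr1.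
have iM (u v : R -> R) : mu.-integrable [set: borelR R] (EFin \o u) ->
    measurable_fun [set: borelR R] v -> (forall x, `|v x| <= 1) ->
    mu.-integrable [set: borelR R] (fun x => (u x * v x)%:E).
  move=> iu mv v1; apply: (le_integrable _ _ _ iu) => //.
    apply/measurable_EFinP/measurable_funM => //.
    by apply/measurable_EFinP; case/integrableP: iu.
  by move=> x _ /=; rewrite lee_fin normrM ler_piMr.
have igh := integrable_shift h _ ig.
set I := \int[mu]_x _.
have I2 : I *+ 2 = \int[mu]_x ((g x - g (x + h)) * w x).
  under eq_Rintegral do rewrite mulrBl.
  rewrite RintegralB//; [|exact: iM..].
  rewrite mulr2n -/I; congr (_ + _).
  rewrite -mulN1r -RintegralZl//; last exact: iM.
  rewrite /I -(Rintegral_shift h (fun x => g x * w x)).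
    by apply: eq_Rintegral => x _; rewrite wh mulN1r mulrN.
  apply: measurable_funM => //.
  by apply/measurable_EFinP; case/integrableP: ig.
have J2 : (\int[mu]_(x in `[b - h, b + h]) g x) *+ 2 =
    \int[mu]_x (g x * a x + g (x + h) * c x).
  rewrite RintegralD//; [|exact: iM..].
  have mch : measurable_fun [set: borelR R] (fun x => c (x - h)).
    exact: (measurableT_comp mc (measurable_shift_by (- h))).
  have -> : \int[mu]_x (g (x + h) * c x) = \int[mu]_x (g x * c (x - h)).
    rewrite -(Rintegral_shift h (fun x => g x * c (x - h))).
      by apply: eq_Rintegral => x _; rewrite addrK.
    apply: measurable_funM => //.
    by apply/measurable_EFinP; case/integrableP: ig.
  rewrite -RintegralD//; [|exact: iM..].
  have igD : mu.-integrable [set: borelR R] (EFin \o (g \_ `[b - h, b + h])).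
    rewrite -restrict_EFin.
    apply: (@integrable_mkcond _ _ _ mu _ (EFin \o g) _).1 => //.
    exact: (@integrableS _ _ _ mu setT).
  rewrite Rintegral_mkcond mulr2n -RintegralD//; apply: eq_Rintegral => x _.
  (* a restriction takes the value point outside its domain *)
  have p0 : point = 0 :> R by [].
  rewrite patchE mem_setE in_itv/= /a /c (lerBlDr x h b) leNgt p0.
  case: ltP => x1 /=; first by rewrite (le_trans (ltW x1)); [ring|lra].
  by case: leP => _; ring.
rewrite -(ler_pMn2r (ltn0Sn 1)) -normrMn I2 J2.
have igd : mu.-integrable [set: borelR R] (EFin \o (fun x => g x - g (x + h))).
  exact: (@integrableB _ _ _ mu _ measurableT _ _ ig igh).
apply: le_trans (le_normr_Rintegral _ _) _ => //.
  exact: iM.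
apply: le_Rintegral => //.
- by apply: (integrable_norm); exact: iM.
- exact: (@integrableD _ _ _ mu _ measurableT _ _
    (iM _ _ ig ma a1) (iM _ _ igh mc c1)).
move=> x _.
rewrite normrM (le_trans (ler_piMr _ (w1 x)))// /a /c.
have ghx := g0 (x + h); have gx := g0 x.
case: (ltP x (b - h)) => xbh; case: (leP x b) => xb.
- have : g x <= g (x + h) by rewrite gi ?in_itv//=; lra.
  by move=> gg; rewrite ler0_norm; lra.
- by lra.
- by rewrite ler_norml; apply/andP; split; lra.
- have : g (x + h) <= g x by rewrite gd ?in_itv//= ?andbT; lra.
  by move=> gg; rewrite ger0_norm; lra.
Qed.

End CrestsOnce.

(** * The Hardy-Littlewood inequality for a set *)

Section Rearrangement.
Context {R : realType}.
Local Open Scope classical_set_scope.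
Local Open Scope ereal_scope.
Local Notation mu := (@lebesgue_measure R).

Lemma tonelli_sections d1 d2 (T1 : measurableType d1) (T2 : measurableType d2)
    (m1 : {sigma_finite_measure set T1 -> \bar R})
    (m2 : {sigma_finite_measure set T2 -> \bar R}) (A : set (T1 * T2)) :
  measurable A ->
  \int[m1]_x m2 (xsection A x) = \int[m2]_y m1 (ysection A y).
Proof.
move=> mA; have := indic_fubini_tonelli m1 m2 mA.
by rewrite indic_fubini_tonelli_FE// indic_fubini_tonelli_GE.
Qed.

Import HBNNSimple.

(** A nonnegative integral is a supremum over simple functions below the
    integrand, so it is monotone for arbitrary integrands; a rearrangement
    can then be compared through its values alone. *)
Lemma ge0_le_integral_pointwise d (T : measurableType d)
    (m : {measure set T -> \bar R}) (D : set T) (f g : T -> \bar R) :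
  (forall x, D x -> 0 <= f x) -> (forall x, D x -> f x <= g x) ->
  \int[m]_(x in D) f x <= \int[m]_(x in D) g x.
Proof.
move=> f0 fg.
have g0 x (Dx : D x) : 0 <= g x := le_trans (f0 x Dx) (fg x Dx).
rewrite !ge0_integralE//.
apply: ereal_sup_le => _ [h /= hf <-]; exists h => // x.
apply: le_trans (hf x) _; rewrite !patchE.
by case: ifPn => // /set_mem Dx; exact: fg.
Qed.

Lemma rearrangement_ge0 (f : R -> R) x : 0 <= rearrangement f x.
Proof. by apply: le_ereal_inf_tmp => _ [a [a0 _] <-]; rewrite lee_fin ltW. Qed.

(** Both integrals are areas of plane regions, sliced horizontally.  At level t
    the region S1 under |f| above E has a slice contained both in E and in
    {|f| > t}, of measure at most min (k c, m t).  Under the graph of the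
    rearrangement on [0, c] lies the region S2, whose slice has measure
    min (c, m t): indeed x < m t forces t to be at most the rearrangement at
    x.  As k >= 1, min (k c, m t) <= k min (c, m t). *)
Lemma hardy_littlewood (f : completedR R -> R) (E : set (completedR R))
    (c k : R) :
  measurable_fun [set: completedR R] f -> measurable E ->
  (0 <= c)%R -> (1 <= k)%R -> leb R E <= (k * c)%:E ->
  \int[leb R]_(x in E) `|f x|%:E <=
    k%:E * \int[leb R]_(x in `[0%R, c]) rearrangement f x.
Proof.
move=> mf mE c0 k1 Ekc.
pose m t := leb R [set s | (t < `|f s|)%R].
have mpos : measurable [set p : completedR R * borelR R | (0 <= p.2)%R].
  have : measurable_fun setT (fun p : completedR R * borelR R => (0 <= p.2)%R).
    by apply: measurable_fun_ler.
  by move=> /(_ measurableT [set true]); rewrite setTI; exact.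
pose G := [set p : completedR R * borelR R | (p.2 < `|f p.1|)%R].
have mG : measurable G.
  have : measurable_fun setT
      (fun p : completedR R * borelR R => (p.2 < `|f p.1|)%R).
    apply: measurable_fun_ltr => //.
    by apply: measurableT_comp => //; exact: measurableT_comp.
  by move=> /(_ measurableT [set true]); rewrite setTI; exact.
have mm : measurable_fun [set: borelR R] m.
  have -> : m = leb R \o ysection G.
    by apply/funext => t /=; rewrite ysectionE.
  exact: measurable_fun_ysection.
have mid : measurable_fun [set: completedR R] (fun x : completedR R => x : R).
  exact: (measurable_fun_leb _ _ (fun x : borelR R => x : R)).
pose S1 := [set p : completedR R * borelR R | E p.1] `&`
  [set p | (0 <= p.2)%R] `&` G.
pose S2 := [set p : completedR R * borelR R | `[0%R, c] p.1] `&`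
  [set p | (0 <= p.2)%R] `&` [set p | p.1%:E < m p.2].
have mS1 : measurable S1.
  apply: measurableI => //; apply: measurableI => //.
  by rewrite -[X in measurable X]setTI; exact: measurable_fst.
have mS2 : measurable S2.
  apply: measurableI; first apply: measurableI => //.
    rewrite -[X in measurable X]setTI; apply: measurable_fst => //.
    exact: measurable_leb.
  rewrite -[X in measurable X]setTI; apply: measurable_lte => //.
    by apply/measurable_EFinP; exact: (measurableT_comp mid measurable_fst).
  exact: measurableT_comp mm _.
have -> : \int[leb R]_(x in E) `|f x|%:E = \int[leb R]_x mu (xsection S1 x).
  rewrite integral_mkcond; apply: eq_integral => x _.
  rewrite patchE; case: ifPn => [/set_mem Ex|/negP xE].
    rewrite [X in mu X](_ : _ = `[0%R, `|f x|%R[%classic).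
      rewrite lebesgue_measure_itv/= lte_fin oppr0 adde0.
      case: ltP (normr_ge0 (f x)) => // fx0 fx1.
      by congr EFin; apply/eqP; rewrite eq_le fx0.
    apply/seteqP; split=> t; rewrite xsectionE/= in_itv/=.
      by move=> [[_ t0] tf]; apply/andP.
    by move=> /andP[].
  rewrite [X in mu X](_ : _ = set0) ?measure0//.
  apply/seteqP; split=> t //; rewrite xsectionE/= => -[[Ex _] _].
  by case: xE; rewrite inE.
rewrite tonelli_sections//.
apply: (@le_trans _ _ (\int[mu]_t (k%:E * leb R (ysection S2 t)))).
  apply: ge0_le_integral_pointwise => // t _.
  have mS1t := @measurable_ysection _ _ _ _ S1 t mS1.
  have mS2t := @measurable_ysection _ _ _ _ S2 t mS2.
  have [t0|t0] := ltP t 0%R.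
    have -> : ysection S1 t = set0.
      apply/seteqP; split=> x //; rewrite ysectionE/= => -[[_]].
      by rewrite /= leNgt t0.
    by rewrite measure0 mule_ge0// lee_fin (le_trans ler01).
  have lebitv i : leb R [set` i] = mu [set` i] by [].
  (* if c < m t the slice of S2 is all of [0, c]; otherwise it is [0, m t[ *)
  have [ct|mtc] := ltP c%:E (m t).
    apply: (@le_trans _ _ (leb R E)).
      apply: le_measure; rewrite ?inE// => x.
      by rewrite ysectionE/= => -[[]].
    apply: (le_trans Ekc); rewrite EFinM; apply: lee_wpmul2l.
      by rewrite lee_fin (le_trans ler01).
    have -> : c%:E = leb R `[0%R, c].
      rewrite lebitv lebesgue_measure_itv/= lte_fin oppr0 adde0.
      by case: ltP => // c0'; congr EFin; apply/eqP; rewrite eq_le c0 c0'.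
    apply: le_measure; rewrite ?inE//; first exact: measurable_leb.
    move=> x; rewrite ysectionE/= => xc; split => //.
    by apply: le_lt_trans ct; move: xc; rewrite in_itv/= lee_fin => /andP[].
  have [r mr] : exists r, m t = r%:E.
    exists (fine (m t)); rewrite fineK// ge0_fin_numE// (le_lt_trans mtc)//.
    exact: ltry.
  have r0 : (0 <= r)%R by rewrite -lee_fin -mr.
  apply: (@le_trans _ _ (m t)).
    apply: le_measure; rewrite ?inE//.
      by have := @measurable_ysection _ _ _ _ G t mG; rewrite ysectionE.
    by move=> x; rewrite ysectionE/= => -[].
  apply: (@le_trans _ _ (k%:E * m t)).
    by rewrite mr -EFinM lee_fin ler_peMl.
  apply: lee_wpmul2l; first by rewrite lee_fin (le_trans ler01).
  have -> : m t = leb R `[0%R, r[.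
    rewrite lebitv lebesgue_measure_itv/= lte_fin oppr0 adde0 mr.
    by case: ltP => // r0'; congr EFin; apply/eqP; rewrite eq_le r0 r0'.
  apply: le_measure; rewrite ?inE//; first exact: measurable_leb.
  move=> x; rewrite ysectionE/= !in_itv/= => /andP[x0 xr]; split.
    by split => //=; rewrite in_itv/= x0 (le_trans (ltW xr))// -lee_fin -mr.
  by rewrite /= mr lte_fin.
have k0 : 0 <= k%:E by rewrite lee_fin (le_trans ler01).
rewrite ge0_integralZl//; last exact: measurable_fun_ysection.
apply: lee_wpmul2l => //.
rewrite -tonelli_sections// [leRHS]integral_mkcond.
apply: ge0_le_integral_pointwise => // x _.
rewrite patchE; case: ifPn => [xc|/negP xc]; last first.
  have -> : xsection S2 x = set0; last by rewrite measure0.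
  apply/seteqP; split=> t //; rewrite xsectionE/= => -[[xc' _] _].
  by case: xc; rewrite inE.
(* a level a with m a <= x bounds every t such that x < m t *)
apply: le_ereal_inf_tmp => _ [a [a0 ax] <-].
have -> : a%:E = mu `[0%R, a].
  by rewrite lebesgue_measure_itv/= lte_fin a0 oppr0 adde0.
apply: le_measure; rewrite ?inE//; first exact: measurable_xsection.
move=> t; rewrite xsectionE/= in_itv/= => -[[_ ->]] /= xm.
rewrite leNgt; apply/negP => ta; move: xm; rewrite ltNge => /negP; apply.
apply: le_trans ax; apply: le_measure; rewrite ?inE.
- by have := @measurable_ysection _ _ _ _ G t mG; rewrite ysectionE.
- by have := @measurable_ysection _ _ _ _ G a mG; rewrite ysectionE.
- by move=> s /=; exact: lt_trans.
Qed.

End Rearrangement.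

(** * Fourier transforms of sums of crests *)

Section FourierOfCrests.
Context {R : realType}.
Local Open Scope classical_set_scope.
Local Open Scope complex_scope.
Local Notation mu := (@lebesgue_measure R).

Lemma le_integrable_leb (g f : completedR R -> R) :
  measurable_fun [set: completedR R] g ->
  (forall x, `|g x| <= `|f x|) ->
  (leb R).-integrable [set: completedR R] (EFin \o f) ->
  (leb R).-integrable [set: completedR R] (EFin \o g).
Proof.
move=> mg gf /integrableP[_ fi]; apply/integrableP; split.
  exact/measurable_EFinP.
apply: le_lt_trans fi; apply: ge0_le_integral_pointwise => x _ //=.
by rewrite lee_fin.
Qed.

(** [crest_oscillation] read for the completed measure, which is the one f is
    integrated against. *)
Lemma crests_once_oscillation (g w : R -> R) (h : R) : 0 < h ->
  (forall x, 0 <= g x) -> crests_once g -> L1 g ->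
  measurable_fun [set: borelR R] w -> (forall x, `|w x| <= 1) ->
  (forall x, w (x + h) = - w x) ->
  exists b, (`|\int[leb R]_x (g x * w x)|%:E <=
    \int[leb R]_(x in `[(b - h)%R, (b + h)%R]) (g x)%:E)%E.
Proof.
move=> h0 g0 cg ig mw w1 wh.
have mg := crests_once_measurable _ cg.
have mgE : measurable_fun [set: borelR R] (EFin \o g) by exact/measurable_EFinP.
have ig' := integrable_leb _ mgE ig.
case: cg => b [gi gd]; exists b.
have -> : \int[leb R]_x (g x * w x) = \int[mu]_x (g x * w x).
  congr fine; apply: (integral_leb (fun x => (g x * w x)%:E)).
  by apply/measurable_EFinP; exact: measurable_funM.
rewrite (ge0_integral_leb _ (EFin \o g))//.
have iD : mu.-integrable `[b - h, b + h] (EFin \o g).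
  exact: (@integrableS _ _ _ mu setT).
rewrite -(@fineK _ (\int[mu]_(x in `[(b - h)%R, (b + h)%R]) (g x)%:E)%E);
  last first.
  exact: integrable_fin_num iD.
by rewrite lee_fin; exact: crest_oscillation.
Qed.

(** Every piece lies below f, and the interval around its crest has length
    2 pi (1 / z), so the Hardy-Littlewood inequality with k = 2 pi bounds all
    the pieces by the same quantity. *)
Lemma rearrangement_oscillation (f : R -> R) (n : nat) (w : R -> R) (z d : R) :
  0 < z -> (forall x, 0 <= f x) -> L1 f -> crest_decomposable f n ->
  measurable_fun [set: borelR R] w -> (forall x, `|w x| <= 1) ->
  (forall x, w (x + pi / z) = - w x) ->
  (\int[leb R]_(x in `[0%R, (1 / z)%R]) rearrangement f x)%E = d%:E ->
  `|\int[leb R]_x (f x * w x)| <= n%:R * (2 * pi * d).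
Proof.
move=> z0 f0 fL [_ [F [F0 F1 _ fE]]] mw w1 wh fd.
have Ff i x : F i x <= f x.
  by rewrite fE (bigD1 i)//= lerDl sumr_ge0.
have mF i : measurable_fun [set: completedR R] (F i).
  exact: measurable_fun_leb (crests_once_measurable _ (F1 i)).
have iF i : L1 (F i).
  by apply: (le_integrable_leb _ _ (mF i) _ fL) => x; rewrite !ger0_norm.
have iFw i : (leb R).-integrable [set: completedR R]
    (fun x => (F i x * w x)%:E).
  apply: (le_integrable_leb (fun x => F i x * w x) (F i)) (iF i).
    by apply: measurable_funM => //; exact: measurable_fun_leb.
  by move=> x; rewrite normrM ler_piMr.
have Fb i : `|\int[leb R]_x (F i x * w x)| <= 2 * pi * d.
  have h0 : 0 < pi / z by rewrite divr_gt0 ?pi_gt0.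
  have [b Hb] :=
    crests_once_oscillation _ _ _ h0 (F0 i) (F1 i) (iF i) mw w1 wh.
  rewrite -lee_fin (le_trans Hb)// EFinM -fd.
  have mE : measurable (`[b - pi / z, b + pi / z] : set (completedR R)).
    exact: measurable_leb.
  have mf : measurable_fun [set: completedR R] f.
    by case/integrableP: fL => /measurable_EFinP.
  apply: le_trans (hardy_littlewood f _ _ (2 * pi) mf mE _ _ _).
  - apply: ge0_le_integral_pointwise => x _; rewrite lee_fin//.
    by rewrite ger0_norm.
  - by rewrite divr_ge0// ltW.
  - have := @pi_ge2 R; lra.
  - rewrite (_ : leb R _ = mu `[b - pi / z, b + pi / z])//.
    rewrite lebesgue_measure_itv/= lte_fin ifT; last by lra.
    by rewrite -EFinB lee_fin mul1r opprB; lra.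
have -> : \int[leb R]_x (f x * w x) = \sum_(i < n) \int[leb R]_x (F i x * w x).
  transitivity (fine (\sum_(i < n) \int[leb R]_x (F i x * w x)%:E)%E).
    rewrite -(@integral_sum _ _ _ (leb R) setT measurableT _ _ iFw _ xpredT).
    congr fine; apply: eq_integral => x _.
    by rewrite sumEFin fE mulr_suml.
  rewrite sum_fine// => i _.
  exact: (@integrable_fin_num _ _ _ (leb R) setT _ _ (iFw i)).
apply: (le_trans (ler_norm_sum _ _ _)).
apply: (le_trans (ler_sum _ (fun i _ => Fb i))).
by rewrite sumr_const card_ord -[leLHS]mulr_natl.
Qed.

Lemma normc_fourier_le (f : R -> R) (z M : R) :
  `|\int[leb R]_x (f x * cos (- (x * z)))| <= M ->
  `|\int[leb R]_x (f x * sin (- (x * z)))| <= M ->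
  ComplexField.Normc.normc (fourier f z) <= Num.sqrt 2 * M.
Proof.
move=> cM sM.
have M0 : 0 <= M := le_trans (normr_ge0 _) cM.
have -> : fourier f z = (\int[leb R]_x (f x * cos (- (x * z)))) +i*
                      (\int[leb R]_x (f x * sin (- (x * z)))).
  congr (_ +i* _); apply: eq_Rintegral => x _ /=; ring.
rewrite /= -[in leRHS](ger0_norm M0) -sqrtr_sqr -sqrtrM// ler_sqrt; last first.
  by rewrite mulr_ge0// sqr_ge0.
by rewrite mulr_natl mulr2n lerD// -real_normK ?num_real// lerXn2r ?nnegrE.
Qed.

End FourierOfCrests.

Theorem theorem2 (R : realType) (f : R -> R) (f_ge0 : forall x, 0 <= f x)
  (f_L1 : L1 f) (N : nat) (N_gt0 : (0 < N)%N) (z : R) (z_gt0 : 0 < z)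
  (QN : N%:R < Q f z) :
  (N%:R%:E < crests f)%E.
Proof.
rewrite ltNge; apply/negP; rewrite /crests.
case: pselect => [ex|_]; last by rewrite leye_eq.
case: ex_minnP => n /asboolP fn _; rewrite lee_fin ler_nat => nN.
move: QN; rewrite ltNge => /negP; apply; rewrite /Q.
set I := (\int[_]_(x in _) _)%E.
have I0 : (0 <= I)%E by apply: integral_ge0 => x _; exact: rearrangement_ge0.
case EI : I I0 => [d| |]//; rewrite ?lee_fin => d0; last first.
  (* were the integral infinite, fine would make the quotient 0 *)
  by rewrite /= mulr0 invr0 mulr0.
have h w mw w1 wh :=
  @rearrangement_oscillation R f n w z d z_gt0 f_ge0 f_L1 fn mw w1 wh EI.
have pz x : (x + pi / z) * z = x * z + pi.
  by rewrite mulrDl divfK// gt_eqF.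
have mxz : measurable_fun setT (fun x : borelR R => - (x * z) : R).
  by apply: measurable_funN; exact: measurable_funM.
have cb : `|\int[leb R]_x (f x * cos (- (x * z)))| <= n%:R * (2 * pi * d).
  apply: (h (fun x => cos (- (x * z)))) => [|x|x].
  - exact: (measurableT_comp (continuous_measurable_fun (@continuous_cos R))
      mxz).
  - by rewrite ler_norml cos_geN1 cos_le1.
  - by rewrite pz !cosN cosDpi.
have sb : `|\int[leb R]_x (f x * sin (- (x * z)))| <= n%:R * (2 * pi * d).
  apply: (h (fun x => sin (- (x * z)))) => [|x|x].
  - exact: (measurableT_comp (continuous_measurable_fun (@continuous_sin R))
      mxz).
  - by rewrite ler_norml sin_geN1 sin_le1.
  - by rewrite pz !sinN sinDpi.
have D0 : 0 <= pi * Num.sqrt 10 * d by rewrite !mulr_ge0 ?pi_ge0.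
have [->|dn0] := eqVneq d 0; first by rewrite mulr0 invr0 mulr0.
rewrite ler_pdivrMr; last first.
  rewrite lt_neqAle D0 andbT eq_sym.
  by rewrite !mulf_neq0// ?gt_eqF ?pi_gt0 ?sqrtr_gt0.
apply: le_trans (normc_fourier_le _ _ _ cb sb) _.
have s8 : Num.sqrt 2 * 2 <= Num.sqrt 10 :> R.
  rewrite -[leLHS]ger0_norm ?mulr_ge0// -sqrtr_sqr.
  by rewrite ler_sqrt ?exprMn ?sqr_sqrtr//; lra.
have -> : Num.sqrt 2 * (n%:R * (2 * pi * d)) =
    n%:R * (pi * (Num.sqrt 2 * 2) * d).
  by ring.
apply: ler_pM; rewrite ?mulr_ge0 ?pi_ge0 ?ler_nat//.
by rewrite ler_wpM2r// ler_wpM2l// pi_ge0.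
Qed.
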